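(* Let $a<b$ be real numbers, let $F$ and $G$ be two (probability) distribution functions on $[a,b]$, and let $n$ be a positive integer. The following three conditions are equivalent: (i) $G \succeq_{n+1,[a,b]-BSD} F$; (ii) $\int_a^b u(x)\,dG(x) \ge \int_a^b u(x)\,dF(x)$ for all $u \in U_{n,[a,b]} \cap LP_{n,[a,b]}$; (iii) $\int_a^b u(x)\,dG(x) \ge \int_a^b u(x)\,dF(x)$ for all $u \in U_{n,[a,b]} \cap AP_{n,[a,b]}$. In particular, $U_{n,[a,b]} \cap AP_{n,[a,b]} = U_{n,[a,b]} \cap LP_{n,[a,b]}$.
   Context: $C^{m}([a,b])$ is the set of $m$ times continuously differentiable functions $u:[a,b]\to\mathbb{R}$ (one-sided derivatives at the endpoints); $u^{(k)}$ is the $k$-th derivative. ''Decreasing'' is in the weak sense. Integrals $\int_a^b \cdot\, dF$ are over the closed interval $[a,b]$, including possible atoms at $a$ and $b$. For a positive integer $n$ and $a<b$: $$U_{n,[a,b]} := \{u \in C^{n+1}([a,b]) : (-1)^{k}u^{(k)}(x) \le 0 \ \ \forall x\in[a,b],\ \forall k=1,\dots,n+1\},$$ $$LP_{n,[a,b]} := \{u:[a,b]\to\mathbb{R} : (u(b)-u(x))^{1/n} \text{ is convex and decreasing (as a function of } x) \text{ on } [a,b]\},$$ $$AP_{n,[a,b]} := \{u\in C^2([a,b]) : u^{(1)}(x)\ge 0,\ u^{(2)}(x)\le 0,\ (n-1)u^{(1)}(x)+u^{(2)}(x)(b-x)\le 0\ \ \forall x\in[a,b]\}.$$ Bounded stochastic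 dominance: for distribution functions $F,G$ on $[a,b]$, $G \succeq_{n+1,[a,b]-BSD} F$ means $$\int_a^b \max\{c-x,0\}^n\,dF(x) \ge \int_a^b \max\{c-x,0\}^n\,dG(x)\quad\text{for all } c\in[a,b].$$ *)

(* Defs.v *)
(* MathComp / MathComp-Analysis, over an arbitrary realType R. *)
From mathcomp Require Export all_boot all_order all_algebra.
From mathcomp Require Export all_classical all_reals all_analysis.

Set Implicit Arguments.
Unset Strict Implicit.
Unset Printing Implicit Defensive.

Export Order.TTheory GRing.Theory Num.Theory.
Export numFieldNormedType.Exports.

Local Open Scope classical_set_scope.
Local Open Scope ring_scope.

(* A function on [a, b] is represented by a total function R -> R; membership in
   the classes below depends only on its restriction to [a, b]. *)
Section functions_on_segment.
Context {R : realType}.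
Implicit Types (a b x : R) (n m k : nat) (u f : R -> R).

(* The derivative relative to [a, b]: y tends to x inside [a, b], so this is the
   two-sided derivative in ]a, b[ and the one-sided derivative at a and at b.
   The library's derivative would look at u outside [a, b]. *)
Definition diff_quot f x : R -> R := fun y => (f y - f x) / (y - x).

Definition derivable_seg a b f x : Prop :=
  cvg (diff_quot f x @ within `[a, b] x^').

Definition derive_seg a b f : R -> R :=
  fun x => lim (diff_quot f x @ within `[a, b] x^').

Definition derive_seg_n a b k u : R -> R := iter k (derive_seg a b) u.

Definition Cm_seg a b m : set (R -> R) :=
  [set u | (forall k, (k < m)%N -> forall x, x \in `[a, b] ->
              derivable_seg a b (derive_seg_n a b k u) x) /\
           {within `[a, b], continuous (derive_seg_n a b m u)}].

Definition U_class n a b : set (R -> R) :=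
  [set u | Cm_seg a b n.+1 u /\
           forall x, x \in `[a, b] -> forall k, (1 <= k <= n.+1)%N ->
             (-1) ^+ k * derive_seg_n a b k u x <= 0].

(* The condition u x <= u b is what makes the real n-th root meaningful: powR
   takes junk values on negative reals. Even when odd roots of negative reals
   are allowed, it follows from the root being decreasing and null at b. *)
Definition LP_class n a b : set (R -> R) :=
  [set u | let v := fun x => (u b - u x) `^ n%:R^-1 in
           [/\ forall x, x \in `[a, b] -> u x <= u b,
               convex_function (`[a, b] : set R^o) v &
               {in `[a, b] &, {homo v : x y / x <= y >-> y <= x}}]].

Definition AP_class n a b : set (R -> R) :=
  [set u | Cm_seg a b 2 u /\
           forall x, x \in `[a, b] ->
             [/\ 0 <= derive_seg_n a b 1 u x,
                 derive_seg_n a b 2 u x <= 0 &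
                 (n%:R - 1) * derive_seg_n a b 1 u x
                   + derive_seg_n a b 2 u x * (b - x) <= 0]].

End functions_on_segment.

Section distribution_functions.
Context {R : realType}.
Implicit Types (a b : R) (n : nat) (F G : cumulativeBounded (0 : R) (1 : R)).

(* A distribution function on [a, b] is extended to the line by 0 on ]-oo, a[
   and by 1 on ]b, +oo[; an atom at a is the jump F a of the extension at a. *)
Definition distribution_on a b F : Prop :=
  (forall x, x < a -> F x = 0) /\ F b = 1.

Definition integral_seg a b F (u : R -> R) : \bar R :=
  (\int[lebesgue_stieltjes_measure F]_(x in `[a, b]) (u x)%:E)%E.

(* BSD n a b G F : G dominates F at order n + 1. *)
Definition BSD n a b G F : Prop :=
  forall c, c \in `[a, b] ->
    (integral_seg a b G (fun x => Num.max (c - x) 0 ^+ n)%R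
       <= integral_seg a b F (fun x => Num.max (c - x) 0 ^+ n)%R)%E.

End distribution_functions.

(* Main.v *)
Require Import Defs.
From mathcomp Require Import ring lra.

(** Put w = u(b) - u. For u in U_n, both the LP and the AP condition bound w or -w' by a multiple
    of a power of b - x, and therefore amount to flatness at b: u^(k)(b) = 0 for 1 <= k < n.
    A flat u has w in the closed convex cone generated by the functions (c - x)_+^n with c in
    [a, b]. Each generator has a convex n-th root, a property that Minkowski's inequality extends
    to the whole cone, and flatness yields the AP inequality by repeated integration from b.
    Dominance on the generators is BSD, so BSD gives the integral inequality for every flat u.
    Conversely -(c - x)_+^n is a uniform limit of flat members of U_n, namely of normalized second
    differences in c of -(c - x)_+^(n+2). *)

Set Implicit Arguments.
Unset Strict Implicit.
Unset Printing Implicit Defensive.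

Local Open Scope classical_set_scope.
Local Open Scope ring_scope.

(** * Sign-alternating families of derivatives *)

Section calculus.
Context {R : realType}.
Implicit Types (a b c x y : R) (f g : R -> R).

(** These are the hypotheses of the mean value theorem: two-sided derivatives inside, while
    continuity carries the estimates to the endpoints. *)
Definition deriv_on a b f g : Prop :=
  {within `[a, b], continuous f} /\
  forall x, x \in `]a, b[ -> is_derive x 1 f (g x).

Lemma deriv_on_mvt a b f g x y : deriv_on a b f g -> a <= x -> x < y -> y <= b ->
  exists2 z, x < z < y & f y - f x = g z * (y - x).
Proof.
move=> [cf df] ax xy yb.
have df' z : z \in `]x, y[ -> is_derive z 1 f (g z).
  rewrite in_itv/= => /andP[xz zy]; apply: df; rewrite in_itv/=.
  by rewrite (le_lt_trans ax)//= (lt_le_trans zy).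
have cf' : {within `[x, y], continuous f}.
  apply: continuous_subspaceW cf => z /=; rewrite !in_itv/= => /andP[xz zy].
  by rewrite (le_trans ax)//= (le_trans zy).
by have [z zxy ->] := MVT xy df' cf'; exists z => //; move: zxy; rewrite in_itv.
Qed.

Lemma deriv_on_le a b f g M x y : deriv_on a b f g ->
  (forall z, a < z < b -> g z <= M) ->
  a <= x -> x <= y -> y <= b -> f y - f x <= M * (y - x).
Proof.
move=> dfg gM ax; rewrite le_eqVlt => /predU1P[->|xy] yb; first by rewrite !subrr mulr0.
have [z /andP[xz zy] ->] := deriv_on_mvt dfg ax xy yb.
by rewrite ler_pM2r ?subr_gt0//; apply: gM; apply/andP; split; lra.
Qed.

Lemma deriv_on_ge a b f g M x y : deriv_on a b f g ->
  (forall z, a < z < b -> M <= g z) ->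
  a <= x -> x <= y -> y <= b -> M * (y - x) <= f y - f x.
Proof.
move=> dfg gM ax; rewrite le_eqVlt => /predU1P[->|xy] yb; first by rewrite !subrr mulr0.
have [z /andP[xz zy] ->] := deriv_on_mvt dfg ax xy yb.
by rewrite ler_pM2r ?subr_gt0//; apply: gM; apply/andP; split; lra.
Qed.

Lemma within_continuous_subl (A : set R) b : {within A, continuous (fun x : R => b - x)}.
Proof.
by apply: continuous_subspaceT => x; apply: cvgB; [exact: cvg_cst|exact: cvg_id].
Qed.

Lemma within_continuousMl (A : set R) (k : R) f :
  {within A, continuous f} -> {within A, continuous (fun x => k * f x)}.
Proof. by move=> cf x; apply: cvgM; [exact: cvg_cst|exact: cf]. Qed.

(* [f k] stands for the sign-corrected derivative [(-1)^k w^(k)] of a function [w]. *)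
Definition alternating a b n (f : nat -> R -> R) : Prop :=
  [/\ forall k, (k <= n)%N -> deriv_on a b (f k) (fun x => - f k.+1 x),
      {within `[a, b], continuous f n.+1} &
      forall k x, (k <= n.+1)%N -> a <= x <= b -> 0 <= f k x].

Lemma alternating_shift a b n (f : nat -> R -> R) :
  alternating a b n.+1 f -> alternating a b n (fun k => f k.+1).
Proof.
by move=> [df cf f0]; split => // [k kn|k x kn]; [exact: df|exact: f0].
Qed.

Lemma alternating_decr a b n (f : nat -> R -> R) k x y : alternating a b n f ->
  (k <= n)%N -> a <= x -> x <= y -> y <= b -> f k y <= f k x.
Proof.
move=> [df cf f0] kn ax xy yb.
have := @deriv_on_le _ _ _ _ 0 x y (df _ kn).
rewrite mul0r subr_le0; apply => // z /andP[az zb].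
by rewrite oppr_le0 f0// !ltW.
Qed.

(** By induction on [m]: the derivative of [f 1 x * (b - x) - (m + 1) * f 0 x] is
    [m * f 1 x - f 2 x * (b - x)], nonpositive by the case [m] for the shifted family, and the
    function vanishes at [b]. *)
Lemma ratio_bound_of_flat a b n (f : nat -> R -> R) m : alternating a b n f ->
  (m <= n)%N -> (forall k, (k < m)%N -> f k b = 0) ->
  forall x, a <= x <= b -> m%:R * f 0%N x <= f 1%N x * (b - x).
Proof.
elim: m n f => [|m IH] n f alt mn fb x /andP[ax xb].
  by rewrite mul0r mulr_ge0 ?subr_ge0//; case: alt => _ _ ->//; rewrite ax.
case: n mn alt => // n mn alt.
have {}IH := IH _ _ (alternating_shift alt) mn (fun k km => fb k.+1 km).
have [df cf f0] := alt.
have [cf0 df0] := df 0%N isT; have [cf1 df1] := df 1%N isT.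
have D : deriv_on a b (fun x => f 1%N x * (b - x) - m.+1%:R * f 0%N x)
    (fun x => m%:R * f 1%N x - f 2%N x * (b - x)).
  split.
    move=> z; apply: cvgB; last exact: within_continuousMl.
    by apply: cvgM; [exact: cf1|exact: within_continuous_subl].
  move=> z zab; have d0 := df0 _ zab; have d1 := df1 _ zab.
  by apply: is_derive_eq; rewrite /GRing.scale /= -natr1; ring.
have := @deriv_on_le _ _ _ _ 0 x b D.
rewrite mul0r !subrr mulr0 fb// mulr0 subr0 sub0r oppr_le0 subr_ge0; apply => // z /andP[az zb].
by rewrite subr_le0 IH// !ltW.
Qed.

(* The hypothesis says that [f 0 x / (b - x)^m] decreases in [x]. *)
Lemma power_bound_of_ratio_bound a b n (f : nat -> R -> R) m : a < b -> alternating a b n f ->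
  (forall x, a <= x <= b -> m%:R * f 0%N x <= f 1%N x * (b - x)) ->
  forall x, a <= x < b -> f 0%N x <= f 0%N a / (b - a) ^+ m * (b - x) ^+ m.
Proof.
move=> ab [df cf f0] H x /andP[ax xb].
have [cf0 df0] := df 0%N isT.
(* Stopping at [x < b] keeps [b - y] away from zero. *)
have D : deriv_on a x (fun y => f 0%N y * (b - y)^-1 ^+ m)
    (fun y => (m%:R * f 0%N y - f 1%N y * (b - y)) * (b - y)^-1 ^+ m.+1).
  split.
    move=> z; apply: cvgM.
      apply: (continuous_subspaceW _ cf0) => t /=; rewrite !in_itv/= => /andP[-> tx]/=.
      by rewrite (le_trans tx)// ltW.
    move: z; apply/continuous_in_subspaceT => z /set_mem/=; rewrite in_itv/= => /andP[az zx].
    apply: (@continuous_comp _ _ _ (fun y => (b - y)^-1) (fun t => t ^+ m));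
      last exact: exprn_continuous.
    apply: cvgV; first by rewrite subr_eq0 gt_eqF// (le_lt_trans zx).
    by apply: cvgB; [exact: cvg_cst|exact: cvg_id].
  move=> z; rewrite in_itv/= => /andP[az zx].
  have bz : b - z != 0 by rewrite subr_eq0 gt_eqF// (lt_trans zx).
  have d0 : is_derive z 1 (f 0%N) (- f 1%N z) by apply: df0; rewrite in_itv/= az (lt_trans zx).
  have d1 : is_derive z 1 (fun y : R => (b - y)^-1) ((b - z) ^- 2).
    have := @is_deriveV R (fun y => b - y) z (-1) 1 bz.
    rewrite /GRing.scale/= mulrN1 opprK; apply.
    by apply: is_derive_eq; ring.
  have d2 := is_deriveX m d1.
  have d3 := is_deriveM d0 d2; rewrite exprfctE in d3.
  apply: (is_derive_eq d3).
  rewrite /GRing.scale/=; case: m {H d2 d3} => [|m]; first by rewrite !expr0 expr1; field.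
  by rewrite /= !exprS -natr1; field.
have := @deriv_on_le _ _ _ _ 0 a x D.
have bx : 0 < b - x by lra.
have ba : 0 < b - a by lra.
rewrite mul0r subr_le0 !exprVn => Q.
rewrite -ler_pdivrMr ?exprn_gt0//; apply: Q => // z /andP[az zx].
rewrite mulr_le0_ge0//.
  by rewrite subr_le0 H//; apply/andP; split; lra.
by rewrite exprn_ge0// invr_ge0 subr_ge0; lra.
Qed.

Lemma le0_of_power_bound (y C d : R) m : 0 < d -> (0 < m)%N ->
  (forall t, 0 < t <= d -> y <= C * t ^+ m) -> y <= 0.
Proof.
move=> d0 m0 H; apply/ler_addgt0Pr => e e0; rewrite add0r.
(* The bound 1 gives [t ^+ m <= t], and the last one gives [t * |C| <= e]; the summand 1 keeps the
   denominator positive when [C = 0]. *)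
pose t := Num.min d (Num.min 1 (e / (1 + `|C|))).
have C1 : 0 < 1 + `|C| by rewrite ltr_pwDl.
have t0 : 0 < t by rewrite !lt_min d0 ltr01 divr_gt0.
suff : C * t ^+ m <= e by apply: le_trans; apply: H; rewrite t0 /t ge_min lexx.
have : t <= 1 by rewrite /t !ge_min lexx orbT.
have : t <= e / (1 + `|C|) by rewrite /t !ge_min lexx !orbT.
rewrite ler_pdivlMr// => te t1.
have tm : t ^+ m <= t by rewrite ler_iXnr// ltW.
apply: le_trans te; rewrite mulrC.
apply: (@le_trans _ _ (t ^+ m * `|C|)); first by rewrite ler_wpM2l ?exprn_ge0 ?ler_norm// ltW.
rewrite mulrDr mulr1 -[leLHS]add0r lerD// ?ler_wpM2r//; exact: ltW.
Qed.

(* The mean value theorem between [2 y - b] and [y] turns [f 0 = O((b - x)^m)] into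
   [f 1 = O((b - x)^(m - 1))]. *)
Lemma flat_of_power_bound a b n (f : nat -> R -> R) m z C : alternating a b n f ->
  (m <= n.+1)%N -> a <= z < b ->
  (forall x, z <= x < b -> f 0%N x <= C * (b - x) ^+ m) ->
  forall k, (k < m)%N -> f k b = 0.
Proof.
elim: m n f z C => // m IH n f z C alt mn /andP[az zb] H [_|k km].
  have [df cf f0] := alt.
  apply/eqP; rewrite eq_le; apply/andP; split; last first.
    by apply: f0 => //; apply/andP; split; lra.
  apply: (@le0_of_power_bound _ C (b - z) m.+1); first lra.
    exact: isT.
  move=> t /andP[t0 tb].
  apply: (@le_trans _ _ (f 0%N (b - t))).
    by apply: (alternating_decr alt) => //; lra.
  by have := H (b - t); rewrite (subKr b t); apply; apply/andP; split; lra.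
case: n mn alt => [|n] mn alt; first by case: m km mn {IH H}.
(* For [y] past the midpoint of [z] and [b], the point [2 * y - b] is still at least [z]; its
   distance to [b] is twice that of [y], whence the factor [2 ^+ m.+1]. *)
apply: (IH _ _ ((z + b) / 2) (C * 2 ^+ m.+1) (alternating_shift alt)) km => //.
  by apply/andP; split; lra.
move=> y /andP[zy yb].
have [||||t /andP[yt tb] E] := @deriv_on_mvt a b (f 0%N) (fun x => - f 1%N x) (2 * y - b) y.
- by case: alt => df _ _; exact: df.
- lra.
- lra.
- lra.
have by0 : 0 < b - y by lra.
rewrite -(ler_pM2r by0).
have -> : C * 2 ^+ m.+1 * (b - y) ^+ m * (b - y) = C * (2 * (b - y)) ^+ m.+1.
  by rewrite exprMn [(b - y) ^+ m.+1]exprSr; ring.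
have := H (2 * y - b); have -> : b - (2 * y - b) = 2 * (b - y) by ring.
move=> H'; apply: (le_trans _ (H' _)); last by apply/andP; split; lra.
apply: (@le_trans _ _ (f 1%N t * (b - y))).
  by rewrite ler_pM2r//; apply: (alternating_decr alt) => //; lra.
have : 0 <= f 0%N y by case: alt => _ _ ->//; apply/andP; split; lra.
have -> : f 1%N t * (b - y) = f 0%N (2 * y - b) - f 0%N y.
  by rewrite -[RHS]opprB E; ring.
lra.
Qed.

End calculus.

(** * Truncated powers *)

Section truncated_powers.
Context {R : realType}.
Implicit Types (a b c x y : R) (s : seq (R * R)).

(* [(c - x)_+^n]; since [0 ^+ 0 = 1], this is the constant [1] for [n = 0]. *)
Definition tpow c n x : R := Num.max (c - x) 0 ^+ n.

Lemma tpow_le c n x : x <= c -> tpow c n x = (c - x) ^+ n.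
Proof. by move=> xc; rewrite /tpow max_l// subr_ge0. Qed.

Lemma tpow_gt c n x : c <= x -> tpow c n.+1 x = 0.
Proof. by move=> cx; rewrite /tpow max_r ?subr_le0// expr0n. Qed.

Lemma continuous_tpow c n : continuous (tpow c n).
Proof.
move=> x; apply: (@continuous_comp _ _ _ (fun x => Num.max (c - x) 0) (fun t => t ^+ n)).
  by apply: continuous_max; [apply: cvgB; [exact: cvg_cst|exact: cvg_id]|exact: cvg_cst].
exact: exprn_continuous.
Qed.

(** On whichever sides of [c] the points [x] and [x + h] lie, the remainder of the first-order
    expansion is at most [h ^+ 2] in absolute value; so the square is differentiable even at its
    knot. *)
Lemma is_derive_tpow2 c x : is_derive x 1 (tpow c 2) (- (2 * tpow c 1 x)).
Proof.
have H : h^-1 *: ((tpow c 2 \o shift x) (h *: (1 : R)) - tpow c 2 x) @[h --> 0^']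
    --> - (2 * tpow c 1 x).
  apply/cvgrPdist_le => e e0; near=> h.
  have h0 : h != 0 by near: h; exact: nbhs_dnbhs_neq.
  apply: (@le_trans _ _ `|h|); last first.
    by near: h; exists e => //= h; rewrite /ball_ /= sub0r normrN => /ltW.
  have -> : - (2 * tpow c 1 x) - h^-1 *: ((tpow c 2 \o shift x) (h *: (1 : R)) - tpow c 2 x)
     = - (h^-1 * (tpow c 2 (x + h) - tpow c 2 x + 2 * tpow c 1 x * h)).
    by rewrite /= /GRing.scale/= mulr1 [h + x]addrC; field.
  rewrite normrN normrM normfV ler_pdivrMl ?normr_gt0// -normrM.
  rewrite [X in _ <= X]ger0_norm -?expr2 ?sqr_ge0//.
  rewrite ler_norml; apply/andP.
  have [xc|/ltW xc] := leP x c; have [hc|/ltW hc] := leP (x + h) c;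
    rewrite ?(tpow_le _ xc) ?(tpow_gt _ xc) ?(tpow_le _ hc) ?(tpow_gt _ hc); split; nra.
split; first by apply/cvg_ex; exists (- (2 * tpow c 1 x)).
exact: (cvg_lim _ H).
Unshelve. all: by end_near. Qed.

Lemma is_derive_tpow c n x :
  is_derive x 1 (tpow c n.+2) (- (n.+2%:R * tpow c n.+1 x)).
Proof.
(* Splitting off the square confines the kink at [c] to [tpow c 2]; the other factor is a
   polynomial. *)
have -> : tpow c n.+2 = (fun y => tpow c 2 y * (c - y) ^+ n).
  apply/funext => y; have [yc|/ltW yc] := leP y c.
    by rewrite !tpow_le// -exprD.
  by rewrite !tpow_gt// mul0r.
have d2 := is_derive_tpow2 c x.
have d1 : is_derive x 1 (fun y : R => c - y) (-1).
  by apply: is_derive_eq; rewrite /GRing.scale /=; ring.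
have := is_deriveM d2 (is_deriveX n d1); rewrite exprfctE => d3.
apply: (is_derive_eq d3); rewrite /GRing.scale/=.
have [xc|/ltW xc] := leP x c; last by rewrite !tpow_gt//; ring.
rewrite !tpow_le//; case: n {d3} => [|n]; first by rewrite expr0; ring.
by rewrite /= !exprS -!natr1; ring.
Qed.

(* The list [s] holds pairs (weight, knot). *)
Definition pw n s x : R := \sum_(p <- s) p.1 * tpow p.2 n x.

Lemma pw_cons n p s x : pw n (p :: s) x = p.1 * tpow p.2 n x + pw n s x.
Proof. by rewrite /pw big_cons. Qed.

Lemma continuous_pw n s : continuous (pw n s).
Proof.
elim: s => [|p s IH] x.
  have -> : pw n [::] = (fun=> 0) by apply/funext => y; rewrite /pw big_nil.
  exact: cvg_cst.
have -> : pw n (p :: s) = (fun y => p.1 * tpow p.2 n y + pw n s y).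
  by apply/funext => y; rewrite pw_cons.
apply: cvgD; last exact: IH.
by apply: cvgM; [exact: cvg_cst|exact: continuous_tpow].
Qed.

(** Integration over [[x, b]] of a term of degree [n], giving one of degree [n + 1]. Knots and signs
    of weights are kept, so cones are preserved. *)
Definition antider n (p : R * R) : R * R := (p.1 / n.+1%:R, p.2).

Lemma is_derive_pw n s x :
  is_derive x 1 (pw n.+2 (map (antider n.+1) s)) (- pw n.+1 s x).
Proof.
elim: s => [|p s IH].
  have -> : pw n.+2 (map (antider n.+1) [::]) = (fun=> 0).
    by apply/funext => y; rewrite /pw big_nil.
  by rewrite /pw big_nil oppr0; exact: is_derive_cst.
have -> : pw n.+2 (map (antider n.+1) (p :: s)) =
    (fun y => (antider n.+1 p).1 * tpow p.2 n.+2 y + pw n.+2 (map (antider n.+1) s) y).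
  by apply/funext => y; rewrite /= pw_cons.
have dp := is_derive_tpow p.2 n x.
apply: is_derive_eq; rewrite pw_cons /GRing.scale/=.
have n0 : n.+2%:R != 0 :> R by rewrite pnatr_eq0.
by field.
Qed.

Definition cone a b s := forall p, p \in s -> 0 <= p.1 /\ a <= p.2 <= b.

Lemma cone_cons a b p s : 0 <= p.1 -> a <= p.2 <= b -> cone a b s -> cone a b (p :: s).
Proof. by move=> p1 p2 cs q; rewrite inE => /predU1P[->|/cs]. Qed.

Lemma pw_end n a b s : cone a b s -> pw n.+1 s b = 0.
Proof.
move=> cs; rewrite /pw big_seq big1// => p /cs[_ /andP[_ pb]].
by rewrite tpow_gt// mulr0.
Qed.

(* Knots are added from right to left; left of the last knot the approximant is affine, with
   the slope that [f 0] has at that knot, so each step of length [d] costs at most [e * d]. *)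
Lemma approx_cone_step a b (f : nat -> R -> R) M (e d : R) k : alternating a b 1 f ->
  f 0%N b = 0 ->
  0 <= e -> 0 <= d -> (forall x, a <= x <= b -> f 2%N x <= M) -> M * d <= e -> a <= b - k%:R * d ->
  exists s, [/\ cone a b s,
    forall x, x <= b - k%:R * d ->
      pw 1 s x = pw 1 s (b - k%:R * d) + f 1%N (b - k%:R * d) * (b - k%:R * d - x) &
    forall x, b - k%:R * d <= x <= b -> `|f 0%N x - pw 1 s x| <= e * (b - x)].
Proof.
move=> alt fb0 e0 d0 fM Md; have [df cf f0] := alt.
elim: k => [|k IH].
  (* Only the point [b] is approximated here; the knot at [b] serves to prescribe the slope to its
     left. *)
  rewrite mul0r subr0 => ab; exists [:: (f 1%N b, b)]; split.
  - apply: cone_cons => //; last by rewrite ab lexx.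
    by apply: f0 => //; rewrite ab lexx.
  - by move=> x xb; rewrite !pw_cons/= /pw !big_nil !tpow_le// subrr; ring.
  - move=> x xb; have -> : x = b by apply/eqP; rewrite eq_le andbC.
    by rewrite fb0 pw_cons/= /pw big_nil tpow_gt// subrr !mulr0 addr0 subr0 normr0.
set c := b - k%:R * d in IH *; have -> : b - k.+1%:R * d = c - d by rewrite /c -natr1; ring.
set c' := c - d => ac'.
have c'c : c' <= c by rewrite /c' gerBl.
have cb : c <= b by rewrite /c gerBl mulr_ge0// ler0n.
have [|s [cs sl sa]] := IH; first lra.
have f1 : f 1%N c <= f 1%N c' by apply: (alternating_decr alt).
have f1M : f 1%N c' - f 1%N c <= e.
  apply: le_trans Md; have := @deriv_on_ge _ a b (f 1%N) (fun x => - f 2%N x) (- M) c' c.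
  have -> : c - c' = d by rewrite /c'; ring.
  move=> /(_ (df 1%N isT)) H; suff : - M * d <= f 1%N c - f 1%N c' by lra.
  by apply: H => // z /andP[az zb]; rewrite lerN2 fM// !ltW.
(* The weight raises the slope from [f 1 c] to [f 1 c'], its value at the next grid point; it is
   nonnegative because [f 1] decreases. *)
exists ((f 1%N c' - f 1%N c, c) :: s).
have E x : x <= c -> pw 1 ((f 1%N c' - f 1%N c, c) :: s) x = pw 1 s c + f 1%N c' * (c - x).
  by move=> xc; rewrite pw_cons/= tpow_le// sl//; ring.
split.
- by apply: cone_cons => //=; rewrite ?subr_ge0// cb andbT (le_trans ac').
- by move=> x xc'; rewrite !E//; [ring|exact: le_trans c'c].
- move=> x /andP[c'x xb]; have [xc|/ltW cx] := leP x c; last first.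
    by rewrite pw_cons tpow_gt// mulr0 add0r sa// cx.
  have ax : a <= x by apply: le_trans c'x.
  rewrite E//; have := sa c; rewrite lexx cb => /(_ isT).
  have [->|xc'] := eqVneq x c; first by rewrite subrr mulr0 addr0.
  have xltc : x < c by rewrite lt_neqAle xc'.
  (* Between [x] and [c] the mean slope of [f 0] is [- f 1 z] and that of the approximant is
     [- f 1 c']; they differ by at most [e]. *)
  have [z /andP[xz zc] fz] := deriv_on_mvt (df 0%N isT) ax xltc cb.
  have fcz : f 1%N c <= f 1%N z.
    by apply: (alternating_decr alt) => //; [exact: le_trans (ltW xz)|exact: ltW].
  have fzc' : f 1%N z <= f 1%N c'.
    apply: (alternating_decr alt) => //; first exact: le_trans (ltW xz).
    exact: le_trans (ltW zc) cb.
  have q0 : 0 <= (f 1%N c' - f 1%N z) * (c - x) by rewrite mulr_ge0// subr_ge0.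
  have qe : (f 1%N c' - f 1%N z) * (c - x) <= e * (c - x).
    by rewrite ler_wpM2r ?subr_ge0//; lra.
  rewrite !ler_norml => /andP[lo hi]; apply/andP; split; lra.
Qed.

Lemma approx_cone1 a b (f : nat -> R -> R) (e : R) : a < b -> alternating a b 1 f ->
  f 0%N b = 0 -> 0 < e ->
  exists s, cone a b s /\ forall x, a <= x <= b -> `|f 0%N x - pw 1 s x| <= e.
Proof.
move=> ab alt fb0 e0; have [df cf f0] := alt.
have [c cab fM] := EVT_max (ltW ab) cf; set M := f 2%N c in fM.
have M0 : 0 <= M by apply: f0 => //; move: cab; rewrite in_itv.
have ba : 0 < b - a by rewrite subr_gt0.
(* Large enough that [M * ((b - a) / N) <= e / (b - a)]; after [N] steps the grid reaches [a]. *)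
pose N := (Num.truncn (M * (b - a) / (e / (b - a)))).+1.
have N0 : 0 < N%:R :> R by rewrite ltr0n.
have NE : N%:R * ((b - a) / N%:R) = b - a by field; exact: lt0r_neq0.
have [|||||s [cs _ sa]] := @approx_cone_step a b f M (e / (b - a)) ((b - a) / N%:R) N alt fb0.
- by rewrite divr_ge0// ltW.
- by rewrite divr_ge0// ltW.
- by move=> x xab; apply: fM; rewrite in_itv.
- rewrite mulrA ler_pdivrMr// [leRHS]mulrC -ler_pdivrMr ?divr_gt0//.
  by apply: ltW; exact: truncnS_gt.
- by rewrite NE subKr.
exists s; split => // x xab; have := sa x; rewrite NE subKr => /(_ xab)/le_trans; apply.
by rewrite mulrAC ler_pdivrMr// ler_pM2l//; lra.
Qed.

(* Integrating from [b] an approximation of [f 1] of degree [n] gives one of [f 0] of degree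
   [n + 1]. *)
Lemma approx_cone a b n (f : nat -> R -> R) (e : R) : a < b -> alternating a b n.+1 f ->
  (forall k, (k < n.+1)%N -> f k b = 0) -> 0 < e ->
  exists s, cone a b s /\ forall x, a <= x <= b -> `|f 0%N x - pw n.+1 s x| <= e.
Proof.
move=> ab; elim: n f e => [|n IH] f e alt fb e0.
  by apply: approx_cone1 => //; exact: fb.
have ba : 0 < b - a by rewrite subr_gt0.
have [|s [cs sa]] := IH _ (e / (b - a)) (alternating_shift alt) (fun k kn => fb k.+1 kn).
  exact: divr_gt0.
have cs' : cone a b (map (antider n.+1) s).
  by move=> _ /mapP[p /cs[p1 p2] ->]; split=> //=; rewrite divr_ge0.
exists (map (antider n.+1) s); split => // x /andP[ax xb].
have [df cf f0] := alt; have [cf0 df0] := df 0%N isT.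
have D : deriv_on a b (fun x => f 0%N x - pw n.+2 (map (antider n.+1) s) x)
    (fun x => pw n.+1 s x - f 1%N x).
  split.
    by move=> z; apply: cvgB; [exact: cf0|exact/continuous_subspaceT/continuous_pw].
  move=> z zab; have d0 := df0 _ zab; have d1 := is_derive_pw n s z.
  by apply: is_derive_eq; ring.
have sa' z : a < z < b -> - (e / (b - a)) <= pw n.+1 s z - f 1%N z <= e / (b - a).
  by move=> /andP[az zb]; rewrite -ler_norml distrC sa// !ltW.
have lo := deriv_on_ge D (fun z zab => (andP (sa' z zab)).1) ax xb (lexx b).
have hi := deriv_on_le D (fun z zab => (andP (sa' z zab)).2) ax xb (lexx b).
have eb : e / (b - a) * (b - x) <= e.
  by rewrite mulrAC ler_pdivrMr// ler_pM2l//; lra.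
move: lo hi; rewrite fb// (pw_end _ cs') ler_norml => lo hi.
by apply/andP; split; lra.
Qed.

End truncated_powers.

(** * Minkowski's inequality and convexity of roots *)

Section root_convexity.
Context {R : realType}.
Implicit Types (a b c x y t u v A B : R) (s : seq (R * R)).

(** Induction on the exponent; the step leaves [t * (1 - t) * (u - v) * (u ^+ n.+1 - v ^+ n.+1)],
    whose last two factors have the same sign. *)
Lemma exprn_convex n t u v : 0 <= t <= 1 -> 0 <= u -> 0 <= v ->
  (t * u + (1 - t) * v) ^+ n.+1 <= t * u ^+ n.+1 + (1 - t) * v ^+ n.+1.
Proof.
move=> /andP[t0 t1] u0 v0; have s0 : 0 <= 1 - t by rewrite subr_ge0.
elim: n => [//|n IH]; rewrite exprS.
have m0 : 0 <= t * u + (1 - t) * v by rewrite addr_ge0// mulr_ge0.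
apply: (le_trans (ler_wpM2l m0 IH)); rewrite -subr_ge0.
have -> : t * u ^+ n.+2 + (1 - t) * v ^+ n.+2 -
    (t * u + (1 - t) * v) * (t * u ^+ n.+1 + (1 - t) * v ^+ n.+1) =
    t * (1 - t) * ((u - v) * (u ^+ n.+1 - v ^+ n.+1)).
  by rewrite 2![_ ^+ n.+2]exprS; ring.
apply: mulr_ge0; first exact: mulr_ge0.
have [uv|/ltW uv] := leP u v.
  by rewrite mulr_le0// subr_le0// lerXn2r.
by rewrite mulr_ge0// subr_ge0// lerXn2r.
Qed.

(* Minkowski's inequality in a form that is linear in the truncated powers, so that it passes
   to positive combinations and to limits; [A] and [B] will be [n]-th roots. *)
Lemma tpow_minkowski n c t x y A B S : S = t * A + (1 - t) * B ->
  0 <= t <= 1 -> 0 < A -> 0 < B ->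
  tpow c n.+1 (t * x + (1 - t) * y) <=
    S ^+ n * (t / A ^+ n * tpow c n.+1 x + (1 - t) / B ^+ n * tpow c n.+1 y).
Proof.
move=> SE t01 A0 B0; have /andP[t0 t1] := t01.
have S0 : 0 < S.
  rewrite SE; have [->|tn0] := eqVneq t 0; first by rewrite mul0r add0r subr0 mul1r.
  by rewrite ltr_wpDr ?mulr_ge0 ?subr_ge0// ?(ltW B0)// mulr_gt0// lt_neqAle eq_sym tn0.
rewrite /tpow; set al := Num.max (c - x) 0; set be := Num.max (c - y) 0.
have al0 : 0 <= al by rewrite le_max lexx orbT.
have be0 : 0 <= be by rewrite le_max lexx orbT.
have alx : c - x <= al by rewrite le_max lexx.
have bey : c - y <= be by rewrite le_max lexx.
have zle : Num.max (c - (t * x + (1 - t) * y)) 0 <= t * al + (1 - t) * be.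
  by rewrite ge_max; apply/andP; split; nra.
apply: (@le_trans _ _ ((t * al + (1 - t) * be) ^+ n.+1)).
  by rewrite lerXn2r// ?nnegrE ?le_max ?lexx ?orbT// (le_trans _ zle)// le_max lexx orbT.
(* Convexity of the power is applied at [al / A] and [be / B] with weights [t * A / S] and
   [(1 - t) * B / S], which sum to 1 and average these points to [(t * al + (1 - t) * be) / S]. *)
have l01 : 0 <= t * A / S <= 1.
  apply/andP; split; first by rewrite divr_ge0 ?mulr_ge0 ?(ltW A0) ?(ltW S0).
  by rewrite ler_pdivrMr// mul1r SE lerDl mulr_ge0 ?subr_ge0// ltW.
have An0 : A != 0 by exact: lt0r_neq0.
have Bn0 : B != 0 by exact: lt0r_neq0.
have Sn0 : S != 0 by exact: lt0r_neq0.
have := @exprn_convex n (t * A / S) (al / A) (be / B) l01.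
have -> : t * A / S * (al / A) + (1 - t * A / S) * (be / B) = (t * al + (1 - t) * be) / S.
  have -> : 1 - t * A / S = (1 - t) * B / S.
    by apply: (mulIf Sn0); rewrite mulrBl !mulfVK// SE; ring.
  by field; rewrite Sn0 An0 Bn0.
have -> : 1 - t * A / S = (1 - t) * B / S.
  by apply: (mulIf Sn0); rewrite mulrBl !mulfVK// SE; ring.
move=> /(_ (divr_ge0 al0 (ltW A0)) (divr_ge0 be0 (ltW B0))).
rewrite !expr_div_n ler_pdivrMr ?exprn_gt0// => /le_trans; apply.
rewrite le_eqVlt; apply/orP; left; apply/eqP.
have ne k z : z != 0 -> z ^+ k != 0 :> R by move=> z0; rewrite expf_neq0.
by rewrite !exprS; field; rewrite Sn0 An0 Bn0 !ne.
Qed.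

Lemma pw_minkowski n a b s t x y A B S : S = t * A + (1 - t) * B ->
  cone a b s -> 0 <= t <= 1 -> 0 < A -> 0 < B ->
  pw n.+1 s (t * x + (1 - t) * y) <=
    S ^+ n * (t / A ^+ n * pw n.+1 s x + (1 - t) / B ^+ n * pw n.+1 s y).
Proof.
move=> SE cs t01 A0 B0; rewrite /pw !mulr_sumr -big_split/= mulr_sumr.
rewrite big_seq [leRHS]big_seq; apply: ler_sum => p /cs[p0 _].
apply: (le_trans (ler_wpM2l p0 (tpow_minkowski n p.2 x y SE t01 A0 B0))).
by rewrite le_eqVlt; apply/orP; left; apply/eqP; ring.
Qed.

(** For fixed [A] and [B] the Minkowski bound is linear in the function, so it passes from the cone
    to [w]. Taking for [A] and [B] the roots of [w x] and [w y] turns it into convexity of the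
    root. *)
Lemma root_convex_of_approx n a b (w : R -> R) :
  (forall x, a <= x <= b -> 0 <= w x) ->
  (forall e, 0 < e -> exists s, cone a b s /\
     forall x, a <= x <= b -> `|w x - pw n.+1 s x| <= e) ->
  forall t x y, 0 <= t <= 1 -> a <= x <= b -> a <= y <= b ->
  w (t * x + (1 - t) * y) `^ n.+1%:R^-1 <=
    t * w x `^ n.+1%:R^-1 + (1 - t) * w y `^ n.+1%:R^-1.
Proof.
move=> w0 wa t x y t01 xab yab; have /andP[t0 t1] := t01.
set z := t * x + (1 - t) * y.
have zab : a <= z <= b.
  by move: xab yab => /andP[ax xb] /andP[ay yb]; apply/andP; split; rewrite /z; nra.
have M A B S : S = t * A + (1 - t) * B -> 0 < A -> 0 < B ->
    w z <= S ^+ n * (t / A ^+ n * w x + (1 - t) / B ^+ n * w y).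
  move=> SE A0 B0.
  have S0 : 0 <= S by rewrite SE addr_ge0 ?mulr_ge0 ?subr_ge0 ?(ltW A0) ?(ltW B0).
  have K0 : 0 <= S ^+ n * (t / A ^+ n + (1 - t) / B ^+ n).
    by rewrite mulr_ge0 ?exprn_ge0// addr_ge0// divr_ge0 ?exprn_ge0 ?subr_ge0 ?(ltW A0) ?(ltW B0).
  set K := (X in 0 <= X) in K0.
  apply/ler_addgt0Pr => e e0.
  have K1 : 0 < 1 + K by rewrite ltr_pwDl.
  (* [K] is the total coefficient on the right, so an error [d] in [w] costs [d + K * d = e]. *)
  have [|s [cs sa]] := wa (e / (1 + K)); first by rewrite divr_gt0.
  have := pw_minkowski n x y SE cs t01 A0 B0; rewrite -/z.
  have := sa _ xab; have := sa _ yab; have := sa _ zab; rewrite !ler_norml.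
  set d := e / (1 + K); move=> /andP[_ z1] /andP[y1 _] /andP[x1 _] H.
  have ed : d + K * d = e by rewrite /d; field; exact: lt0r_neq0.
  have : S ^+ n * (t / A ^+ n * pw n.+1 s x + (1 - t) / B ^+ n * pw n.+1 s y) <=
      S ^+ n * (t / A ^+ n * (w x + d) + (1 - t) / B ^+ n * (w y + d)).
    rewrite ler_wpM2l ?exprn_ge0// lerD// ler_wpM2l ?divr_ge0 ?exprn_ge0 ?subr_ge0
      ?(ltW A0) ?(ltW B0)//; lra.
  have -> : S ^+ n * (t / A ^+ n * (w x + d) + (1 - t) / B ^+ n * (w y + d)) =
      S ^+ n * (t / A ^+ n * w x + (1 - t) / B ^+ n * w y) + K * d by rewrite /K; ring.
  lra.
apply/ler_addgt0Pr => e e0.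
set r := n.+1%:R^-1; have r0 : 0 < r :> R by rewrite invr_gt0 ltr0n.
have rootK v : 0 <= v -> (v `^ r) ^+ n.+1 = v.
  by move=> v0; rewrite -powR_mulrn ?powR_ge0// -powRrM mulVf ?pnatr_eq0// powRr1.
(* The summand [e] keeps both numbers positive when [w] vanishes at [x] or [y]. *)
set A := w x `^ r + e; set B := w y `^ r + e.
have A0 : 0 < A by rewrite ltr_wpDl ?powR_ge0.
have B0 : 0 < B by rewrite ltr_wpDl ?powR_ge0.
have wA : w x <= A ^+ n.+1.
  rewrite -[leLHS](rootK _ (w0 _ xab)) lerXn2r// ?nnegrE ?powR_ge0 ?(ltW A0)// lerDl; exact: ltW.
have wB : w y <= B ^+ n.+1.
  rewrite -[leLHS](rootK _ (w0 _ yab)) lerXn2r// ?nnegrE ?powR_ge0 ?(ltW B0)// lerDl; exact: ltW.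
set S := t * A + (1 - t) * B; have {M} := M _ _ S erefl A0 B0.
have S0 : 0 <= S by rewrite addr_ge0 ?mulr_ge0 ?subr_ge0 ?(ltW A0) ?(ltW B0).
have -> : t * w x `^ r + (1 - t) * w y `^ r + e = S by rewrite /S /A /B; ring.
move=> wS; have {}wS : w z <= S ^+ n.+1.
  apply: (le_trans wS); rewrite exprSr ler_wpM2l ?exprn_ge0// /S.
  have E v k : 0 < v -> v = v ^+ k.+1 / v ^+ k :> R.
    by move=> v0; rewrite exprS mulfK// expf_neq0// lt0r_neq0.
  (* Since [w x <= A ^+ n.+1], the quotient of [w x] by [A ^+ n] is at most [A], and likewise for
     [B]; the bracket is therefore at most [S]. *)
  rewrite {2}(E A n A0) {2}(E B n B0) lerD//.
    by rewrite -mulrA ler_wpM2l// mulrC ler_wpM2r// invr_ge0 exprn_ge0// ltW.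
  rewrite -mulrA ler_wpM2l ?subr_ge0// mulrC ler_wpM2r// invr_ge0 exprn_ge0//; exact: ltW.
have -> : S = (S ^+ n.+1) `^ r.
  by rewrite -powR_mulrn// -powRrM mulfV ?pnatr_eq0// powRr1.
by rewrite ge0_ler_powR// ?(ltW r0)// ?nnegrE ?exprn_ge0//; exact: w0.
Qed.

End root_convexity.

(** * The classes of utilities *)

Section segment_derivatives.
Context {R : realType}.
Implicit Types (a b c x y l e : R) (u f g : R -> R).

Lemma diff_quot_cvgP a b f x l :
  diff_quot f x @ within `[a, b] x^' --> l <->
  forall e, 0 < e -> exists2 d, 0 < d & forall y, a <= y <= b -> y != x ->
    `|y - x| < d -> `|l - diff_quot f x y| <= e.
Proof.
split.
  move=> /cvgrPdist_le H e /H [d /= d0 Hd]; exists d => // y yab yx yd.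
  by apply: Hd => //=; rewrite ?in_itv// /ball_/= distrC.
move=> H; apply/cvgrPdist_le => e /H[d d0 Hd]; exists d => //= y yd yx.
by rewrite /= in_itv/= => yab; apply: Hd => //; rewrite distrC.
Qed.

(** Limits of difference quotients are unique because each point of the segment is approached within
    it: from the right if [x < b], otherwise from the left. *)
Lemma dnbhs_seg_proper a b x : a < b -> a <= x <= b ->
  ProperFilter (within (`[a, b] : set R) x^').
Proof.
move=> ab /andP[ax xb]; apply: Build_ProperFilter => -[d /= d0 Hd].
have [xltb|bx] := ltP x b.
  pose m := Num.min (d / 2) (b - x).
  have m0 : 0 < m by rewrite lt_min divr_gt0//= subr_gt0.
  have md : m <= d / 2 by rewrite /m ge_min lexx.
  have mb : m <= b - x by rewrite /m ge_min lexx orbT.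
  apply: (Hd (x + m)) => /=.
  - by rewrite /ball_/= opprD addrA subrr sub0r normrN gtr0_norm//; lra.
  - by rewrite gt_eqF// ltrDl.
  - by rewrite in_itv/=; apply/andP; split; lra.
pose m := Num.min (d / 2) (b - a).
have m0 : 0 < m by rewrite lt_min divr_gt0//= subr_gt0.
have md : m <= d / 2 by rewrite /m ge_min lexx.
have mb : m <= b - a by rewrite /m ge_min lexx orbT.
apply: (Hd (x - m)) => /=.
- by rewrite /ball_/= subKr gtr0_norm//; lra.
- by rewrite lt_eqF// gtrBl.
- by rewrite in_itv/=; apply/andP; split; lra.
Qed.

Lemma derive_segP a b f x l : a < b -> a <= x <= b ->
  diff_quot f x @ within `[a, b] x^' --> l ->
  derivable_seg a b f x /\ derive_seg a b f x = l.
Proof.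
move=> ab xab fl; have Fx := dnbhs_seg_proper ab xab.
by split; [exact: cvgP fl|exact: (cvg_lim _ fl)].
Qed.

Lemma diff_quot_is_derive a b f x l : a < x < b ->
  diff_quot f x @ within `[a, b] x^' --> l -> is_derive x 1 f l.
Proof.
move=> /andP[ax xb] /diff_quot_cvgP fl.
have H : h^-1 *: ((f \o shift x) (h *: (1 : R)) - f x) @[h --> 0^'] --> l.
  apply/cvgrPdist_le => e /fl[d d0 Hd]; near=> h.
  have h0 : h != 0 by near: h; exact: nbhs_dnbhs_neq.
  have hd : `|h| < Num.min d (Num.min (x - a) (b - x)).
    near: h; exists (Num.min d (Num.min (x - a) (b - x))) => /=.
      by rewrite !lt_min d0 !subr_gt0 ax.
    by move=> h; rewrite /ball_ /= sub0r normrN.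
  move: hd; rewrite !lt_min => /and3P[hd].
  rewrite !ltr_norml => /andP[ha1 ha2] /andP[hb1 hb2].
  have := Hd (x + h); rewrite addrAC subrr add0r -subr_eq0 addrAC subrr add0r.
  rewrite /diff_quot /GRing.scale/= mulr1 [h + x]addrC addrAC subrr add0r [_^-1 * _]mulrC.
  by apply => //; apply/andP; split; lra.
split; first by apply/cvg_ex; exists l.
exact: (cvg_lim _ H).
Unshelve. all: by end_near. Qed.

Lemma is_derive_diff_quot a b f x l :
  is_derive x 1 f l -> diff_quot f x @ within `[a, b] x^' --> l.
Proof.
move=> [df dl]; apply/diff_quot_cvgP => e e0.
have : h^-1 *: ((f \o shift x) (h *: (1 : R)) - f x) @[h --> 0^'] --> l.
  by rewrite -dl.
move=> /cvgrPdist_le/(_ _ e0)[d /= d0 Hd]; exists d => // y _ yx yd.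
have := Hd (y - x); rewrite /ball_/= sub0r normrN => /(_ yd); rewrite subr_eq0 => /(_ yx).
by rewrite /GRing.scale/= mulr1 subrK /diff_quot mulrC.
Qed.

Lemma diff_quot_continuous a b f x l :
  diff_quot f x @ within `[a, b] x^' --> l -> f @ within `[a, b] (nbhs x) --> f x.
Proof.
move=> /diff_quot_cvgP/(_ 1 ltr01)[d d0 Hd].
apply/cvgrPdist_le => e e0.
have L0 : 0 < `|l| + 1 by rewrite ltr_wpDl.
exists (Num.min d (e / (`|l| + 1))) => /=; first by rewrite lt_min d0 divr_gt0.
move=> y; rewrite /ball_/= lt_min => /andP[yd ye]; rewrite in_itv/= => yab.
have [->|yx] := eqVneq y x; first by rewrite subrr normr0 ltW.
have := Hd y yab yx; rewrite distrC => /(_ yd).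
have -> : f x - f y = diff_quot f x y * (x - y).
  rewrite /diff_quot -[x - y]opprB mulrN mulfVK ?opprB// subr_eq0//.
rewrite normrM => H; apply: (@le_trans _ _ ((`|l| + 1) * `|x - y|)).
  rewrite ler_wpM2r// -[diff_quot f x y](subKr l).
  by rewrite (le_trans (ler_normB _ _))// lerD2l.
by rewrite mulrC -ler_pdivlMr// ltW.
Qed.

Lemma diff_quot_eq a b f g x l : a <= x <= b -> (forall y, a <= y <= b -> f y = g y) ->
  diff_quot f x @ within `[a, b] x^' --> l -> diff_quot g x @ within `[a, b] x^' --> l.
Proof.
move=> xab fg /diff_quot_cvgP H; apply/diff_quot_cvgP => e /H[d d0 Hd].
by exists d => // y yab yx yd; have := Hd y yab yx yd; rewrite /diff_quot !fg.
Qed.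

Lemma Cm_seg_deriv_on a b m u k : Cm_seg a b m u -> (k < m)%N ->
  deriv_on a b (derive_seg_n a b k u) (derive_seg_n a b k.+1 u).
Proof.
move=> [du _] km; split.
  apply/subspace_continuousP => x xab.
  by apply: diff_quot_continuous; exact: du.
move=> x; rewrite in_itv/= => xab; apply: (diff_quot_is_derive xab).
by apply: du => //; rewrite in_itv/=; case/andP: xab => /ltW-> /ltW->.
Qed.

Lemma Cm_segW a b m k u : (k <= m)%N -> Cm_seg a b m u -> Cm_seg a b k u.
Proof.
rewrite leq_eqVlt => /predU1P[-> //|km] um; split.
  by move=> j jk; case: um => du _; apply: du; exact: ltn_trans km.
by case: (Cm_seg_deriv_on um km).
Qed.

(** Membership for functions with derivatives on the whole line. The iterated segment derivatives
    are known to equal [g k] only on [[a, b]], which suffices since the difference quotients are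
    taken there. *)
Lemma Cm_seg_of_is_derive a b m (g : nat -> R -> R) : a < b ->
  (forall k x, (k < m)%N -> is_derive x 1 (g k) (g k.+1 x)) -> continuous (g m) ->
  Cm_seg a b m (g 0%N) /\
  forall k x, (k <= m)%N -> a <= x <= b -> derive_seg_n a b k (g 0%N) x = g k x.
Proof.
move=> ab dg cg.
have dE k x : (k < m)%N -> a <= x <= b ->
    (forall y, a <= y <= b -> derive_seg_n a b k (g 0%N) y = g k y) ->
    diff_quot (derive_seg_n a b k (g 0%N)) x @ within `[a, b] x^' --> g k.+1 x.
  move=> km xab E; apply: (diff_quot_eq xab (fun y yab => esym (E y yab))).
  by apply: is_derive_diff_quot; exact: dg.
have E k : (k <= m)%N -> forall x, a <= x <= b -> derive_seg_n a b k (g 0%N) x = g k x.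
  elim: k => [//|k IH] km x xab.
  by case: (derive_segP ab xab (dE _ _ km xab (IH (ltnW km)))).
split; last by move=> k x km; exact: E.
split.
  move=> k km x; rewrite in_itv/= => xab.
  by case: (derive_segP ab xab (dE _ _ km xab (E _ (ltnW km)))).
apply/subspace_continuousP => x xab; move: (xab); rewrite /= in_itv/= => xab'.
suff : derive_seg_n a b m (g 0%N) @ within `[a, b] (nbhs x) --> g m x.
  by rewrite -(E m (leqnn m) x xab').
have := @cvg_within_filter _ _ _ _ (nbhs_filter x) _ `[a, b]%classic (cg x).
apply: cvg_trans; apply: near_eq_cvg; rewrite /prop_near1 /=.
by exists 1 => //= y _; rewrite in_itv/= => /E->.
Qed.

End segment_derivatives.

(** * Flatness at [b] characterizes both intersections *)

Section classes.
Context {R : realType} (a b : R).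
Hypothesis ab : a < b.
Implicit Types (n k m : nat) (c x y d e : R) (u : R -> R).

(* [(-1)^k w^(k)] for [w = u b - u]. *)
Definition rev_family u k : R -> R :=
  if k is 0 then fun x => u b - u x
  else fun x => (-1) ^+ k.+1 * derive_seg_n a b k u x.

(** For [k >= 1] the signs are those required in [U_class]; for [k = 0] nonnegativity holds because
    [u] increases. *)
Lemma alternating_rev_family n u : U_class n a b u -> alternating a b n (rev_family u).
Proof.
move=> [Cu su].
have dk k kn := Cm_seg_deriv_on Cu (kn : (k < n.+1)%N).
have u10 x : a < x < b -> 0 <= derive_seg_n a b 1 u x.
  move=> /andP[ax xb]; have := su x; rewrite in_itv/= (ltW ax) (ltW xb) => /(_ isT 1%N isT).
  by rewrite expr1 mulN1r oppr_le0.
split.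
- move=> k kn; have [cu du] := dk _ kn; split.
    case: k cu {kn du} => [|k] cu; last exact: within_continuousMl.
    by move=> z; apply: cvgB; [exact: cvg_cst|exact: cu].
  move=> x xab; have dx := du _ xab.
  case: k dx {kn cu du} => [|k] dx.
    have dx' : is_derive x 1 u (derive_seg_n a b 1 u x) by exact: dx.
    by apply: is_derive_eq; rewrite /= !exprS expr0; ring.
  by apply: is_derive_eq; rewrite /GRing.scale /= !exprS; ring.
- by apply: within_continuousMl; case: Cu.
- case=> [|k] x kn /andP[ax xb].
    have := deriv_on_ge (dk 0%N isT) u10 ax xb (lexx b).
    by rewrite mul0r.
  have := su x; rewrite in_itv/= ax xb => /(_ isT k.+1); rewrite kn => /(_ isT).
  by rewrite /= [(-1) ^+ k.+2]exprS mulN1r mulNr oppr_ge0.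
Qed.

(* For [k = 0] the condition holds by definition of [rev_family]; it says that
   [u^(k) b = 0] for [1 <= k < n]. *)
Definition flat n u := forall k, (k < n)%N -> rev_family u k b = 0.

(** The AP inequality is the ratio bound with [m = n - 1] for the family starting at [u']; it makes
    [u'] of order [(b - x) ^+ (n - 1)], which forces the derivatives at [b] to vanish. *)
Lemma flat_of_AP n u : (0 < n)%N -> U_class n a b u -> AP_class n a b u -> flat n u.
Proof.
case: n => // n _ Uu [_ APu]; have alt := alternating_shift (alternating_rev_family Uu).
have H x : a <= x <= b -> n%:R * rev_family u 1 x <= rev_family u 2 x * (b - x).
  move=> xab; have [_ _] := APu x xab.
  rewrite -natr1 addrK /rev_family !exprS expr0 => H'; lra.
case=> [_|k kn]; first by rewrite /= subrr.
apply: (flat_of_power_bound alt (leqnSn n) (z := a)) (kn); first by rewrite lexx.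
exact: (power_bound_of_ratio_bound ab alt H).
Qed.

Lemma AP_of_flat n u : (0 < n)%N -> U_class n a b u -> flat n u -> AP_class n a b u.
Proof.
case: n => // n _ Uu fu; have alt := alternating_shift (alternating_rev_family Uu).
split; first by case: Uu => Cu _; exact: Cm_segW Cu.
move=> x xab; case: (Uu) => _ /(_ x xab) su; split.
- by have := su 1%N isT; rewrite expr1 mulN1r oppr_le0.
- by have := su 2%N isT; rewrite sqrrN expr1n mul1r.
have := @ratio_bound_of_flat _ _ _ _ _ n alt (leqnn n) (fun k kn => fu k.+1 kn) x xab.
rewrite -natr1 addrK /rev_family !exprS expr0; lra.
Qed.

(* The convex function [(u b - u)^(1/n)] vanishes at [b], hence lies below its chord. *)
Lemma flat_of_LP n u : (0 < n)%N -> U_class n a b u -> LP_class n a b u -> flat n u.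
Proof.
move=> n0 Uu [uub cvx _]; have alt := alternating_rev_family Uu.
set v := (fun x => _) in cvx.
have ba : 0 < b - a by rewrite subr_gt0.
apply: (flat_of_power_bound alt (leqnSn n) (z := a) (C := (v a / (b - a)) ^+ n)).
  by rewrite lexx.
move=> x /andP[ax xb].
(* This is the weight of [a] when [x] is written as a convex combination of [a] and [b]. *)
have t0 : 0 <= (b - x) / (b - a) by rewrite divr_ge0 ?subr_ge0// ltW.
have t1 : (b - x) / (b - a) <= 1 by rewrite ler_pdivrMr// mul1r lerD2l lerN2.
have nn0 : n%:R != 0 :> R by rewrite pnatr_eq0 -lt0n.
have := cvx (Itv01 t0 t1) a b; rewrite !inE/= !in_itv/= !lexx (ltW ab) => /(_ isT isT).
rewrite convRE [X in v X <= _]convRE /=.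
have -> : (b - x) / (b - a) * a + unstable.onem ((b - x) / (b - a)) * b = x.
  by rewrite /unstable.onem; field; exact: lt0r_neq0.
(* The exponent must be nonzero here, as [powR] sends 0 to 1 at exponent 0. *)
have -> : v b = 0 by rewrite /v subrr powR0// invr_neq0.
rewrite mulr0 addr0 => vx.
have vxn : v x ^+ n = u b - u x.
  rewrite /v -powR_mulrn ?powR_ge0// -powRrM mulVf// powRr1// subr_ge0 uub//.
  by rewrite in_itv/= ax ltW.
rewrite /= -vxn -exprMn lerXn2r ?nnegrE ?powR_ge0//; last by rewrite mulrAC -mulrA mulrC.
by rewrite mulr_ge0 ?divr_ge0 ?powR_ge0 ?subr_ge0// ltW.
Qed.

Lemma LP_of_flat n u : (0 < n)%N -> U_class n a b u -> flat n u -> LP_class n a b u.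
Proof.
case: n => // n _ Uu fu; have alt := alternating_rev_family Uu.
have w0 x : a <= x <= b -> 0 <= u b - u x by move=> xab; case: (alt) => _ _ /(_ 0%N x isT xab).
split.
- by move=> x; rewrite in_itv/= => /w0; rewrite subr_ge0.
- move=> t x y; rewrite !inE/= !in_itv/= => xab yab.
  rewrite convRE [X in (_ - u X) `^ _ <= _]convRE.
  apply: (root_convex_of_approx w0) => //; last by rewrite ge0 le1.
  by move=> e; apply: (approx_cone ab alt).
move=> x y; rewrite !in_itv/= => /andP[ax xb] /andP[ay yb] xy.
rewrite ge0_ler_powR ?nnegrE ?invr_ge0 ?ler0n ?w0 ?ax ?ay//.
exact: (@alternating_decr _ _ _ _ _ 0%N _ _ alt isT ax xy yb).
Qed.

Lemma U_AP_eq_U_LP n : (0 < n)%N ->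
  U_class n a b `&` AP_class n a b = U_class n a b `&` LP_class n a b.
Proof.
move=> n0; apply/seteqP; split => u [Uu].
  by move=> /(flat_of_AP n0 Uu)/(LP_of_flat n0 Uu).
by move=> /(flat_of_LP n0 Uu)/(AP_of_flat n0 Uu).
Qed.

End classes.

(** * Smooth approximation of truncated powers *)

Section smoothing.
Context {R : realType}.
Implicit Types (a b : R) (n k m : nat) (c x y d e L : R) (u : R -> R).

(** A second difference in the knot. For [d > 0] the knots step to the left, so with [c <= b] none
    of them exceeds [b] and the function vanishes at [b] when [m > 0]. *)
Definition dtpow c d m x := tpow c m x - 2 * tpow (c - d) m x + tpow (c - 2 * d) m x.

(** Midpoint convexity between [x] and [x + 2 * d], from the Minkowski bound with [A = B = 1]:
    lowering the knot by [d] amounts to moving [x] by [d]. *)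
Lemma dtpow_ge0 c d m x : 0 <= dtpow c d m.+1 x.
Proof.
have half01 : 0 <= (2^-1 : R) <= 1 by apply/andP; split; lra.
have := @tpow_minkowski R m c 2^-1 x (x + 2 * d) 1 1 1 _ half01 ltr01 ltr01.
rewrite !expr1n !divr1 mul1r => /(_ ltac:(lra)).
have -> : 2^-1 * x + (1 - 2^-1) * (x + 2 * d) = x + d by lra.
rewrite /dtpow /tpow.
have -> : c - (x + d) = c - d - x by ring.
have -> : c - (x + 2 * d) = c - 2 * d - x by ring.
lra.
Qed.

Lemma is_derive_dtpow c d m x :
  is_derive x 1 (dtpow c d m.+2) (- (m.+2%:R * dtpow c d m.+1 x)).
Proof.
have d0 := is_derive_tpow c m x; have d1 := is_derive_tpow (c - d) m x.
have d2 := is_derive_tpow (c - 2 * d) m x.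
by apply: is_derive_eq; rewrite /dtpow /GRing.scale/=; ring.
Qed.

Lemma tpow_shift c n x d : tpow (c - d) n x = tpow c n (x + d).
Proof. by rewrite /tpow; congr (Num.max _ 0 ^+ _); ring. Qed.

Lemma dtpow_mvt c d n x : 0 < d ->
  exists2 y, x <= y <= x + 2 * d & dtpow c d n.+3 x = (n.+3 * n.+2)%:R * d ^+ 2 * tpow c n.+1 y.
Proof.
move=> d0.
(* [k = 1] gives the first difference in the knot and [k = 0] the power itself; the mean value
   theorem is applied to one and then the other, each time over a length [d]. *)
have D m (k : R) : deriv_on x (x + 2 * d) (fun y => tpow c m.+2 y - k * tpow (c - d) m.+2 y)
    (fun y => - (m.+2%:R * (tpow c m.+1 y - k * tpow (c - d) m.+1 y))).
  split.
    apply: continuous_subspaceT => y; apply: cvgB; first exact: continuous_tpow.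
    by apply: cvgM; [exact: cvg_cst|exact: continuous_tpow].
  move=> y _; have d1 := is_derive_tpow c m y; have d2 := is_derive_tpow (c - d) m y.
  by apply: is_derive_eq; rewrite /GRing.scale/=; ring.
have [||z /andP[xz zd]] := deriv_on_mvt (D n.+1 1) (lexx x) (_ : x < x + d); [lra..|].
rewrite !mul1r -!tpow_shift => Ez.
have [|||y /andP[zy yd]] := deriv_on_mvt (D n 0) (_ : x <= z) (_ : z < z + d); [lra..|].
rewrite !mul0r !subr0 -!tpow_shift => Ey.
exists y; first by apply/andP; split; lra.
have -> : dtpow c d n.+3 x = - (tpow (c - d) n.+3 x - tpow (c - d - d) n.+3 x
    - (tpow c n.+3 x - tpow (c - d) n.+3 x)).
  rewrite /dtpow; have -> : c - 2 * d = c - d - d by ring.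
  ring.
rewrite Ez natrM.
have -> : tpow c n.+2 z - tpow (c - d) n.+2 z = - (tpow (c - d) n.+2 z - tpow c n.+2 z) by ring.
by rewrite Ey; ring.
Qed.

Lemma exprB_le n L x y : 0 <= y -> y <= x -> x <= L ->
  x ^+ n.+1 - y ^+ n.+1 <= n.+1%:R * L ^+ n * (x - y).
Proof.
move=> y0 yx xL; have x0 : 0 <= x by exact: le_trans yx.
have L0 : 0 <= L by exact: le_trans xL.
have xy0 : 0 <= x - y by rewrite subr_ge0.
elim: n => [|n IH]; first by rewrite expr0 !mul1r.
have -> : x ^+ n.+2 - y ^+ n.+2 = x * (x ^+ n.+1 - y ^+ n.+1) + y ^+ n.+1 * (x - y).
  by rewrite [x ^+ _.+2]exprS [y ^+ _.+2]exprS; ring.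
have -> : n.+2%:R * L ^+ n.+1 * (x - y) =
    L * (n.+1%:R * L ^+ n * (x - y)) + L ^+ n.+1 * (x - y).
  by rewrite -[n.+2%:R]natr1 exprS; ring.
have yL : y ^+ n.+1 <= L ^+ n.+1 by rewrite lerXn2r// (le_trans yx).
rewrite lerD// ?ler_wpM2r//.
apply: (le_trans (ler_wpM2l x0 IH)); rewrite ler_wpM2r//.
by rewrite !mulr_ge0// ?ler0n ?exprn_ge0.
Qed.

Lemma tpow_modulus n a c x y d : a <= x <= y -> y <= x + d -> a <= c ->
  0 <= tpow c n.+1 x - tpow c n.+1 y <= n.+1%:R * (c - a) ^+ n * d.
Proof.
move=> /andP[ax xy] yd ac.
rewrite /tpow; set X := Num.max (c - x) 0; set Y := Num.max (c - y) 0.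
have Y0 : 0 <= Y by rewrite le_max lexx orbT.
have YX : Y <= X.
  by rewrite ge_max !le_max lexx orbT andbT lerD2l lerN2 xy.
have XL : X <= c - a by rewrite ge_max subr_ge0 ac andbT lerD2l lerN2.
have XY : X - Y <= d.
  rewrite lerBlDr ge_max.
  have : c - y <= Y by rewrite le_max lexx.
  by move=> ?; apply/andP; split; lra.
have X0 := le_trans Y0 YX.
rewrite subr_ge0 lerXn2r// (le_trans (exprB_le n Y0 YX XL))//.
by rewrite ler_wpM2l// mulr_ge0 ?ler0n// exprn_ge0// subr_ge0.
Qed.

(* The [k]-th derivative of [- dtpow c d n.+2 / ((n + 2) (n + 1) d^2)], a [C^(n + 1)]
   approximation of [- tpow c n]. *)
Definition smooth_utility n c d k x : R :=
  - ((-1) ^+ k * (n.+2 ^_ k)%:R / ((n.+2 * n.+1)%:R * d ^+ 2) * dtpow c d (n.+2 - k) x).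

Lemma is_derive_smooth_utility n c d k x : (k < n.+1)%N ->
  is_derive x 1 (smooth_utility n c d k) (smooth_utility n c d k.+1 x).
Proof.
move=> kn; rewrite /smooth_utility ffactnSr.
(* The remaining degree is then [i.+2], high enough for the truncated powers to be
   differentiable. *)
have [i ->] : exists i, n = (k + i)%N by exists (n - k)%N; rewrite subnKC.
have E1 : ((k + i).+2 - k = i.+2)%N by rewrite -!addnS addKn.
have E2 : ((k + i).+2 - k.+1 = i.+1)%N by rewrite subSS -addnS addKn.
rewrite E1 E2; have dD := is_derive_dtpow c d i x.
set K := (_ * d ^+ 2)^-1.
apply: is_derive_eq; rewrite /GRing.scale/= natrM exprS -/K. ring.
Qed.

Lemma smooth_utility_U_flat a b n c d : a < b -> 0 < d -> c <= b ->
  U_class n a b (smooth_utility n c d 0) /\ flat a b n (smooth_utility n c d 0).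
Proof.
move=> ab d0 cb.
have cont : continuous (smooth_utility n c d n.+1).
  move=> x; apply: cvgN; apply: cvgM; first exact: cvg_cst.
  apply: cvgD; last exact: continuous_tpow.
  apply: cvgB; first exact: continuous_tpow.
  by apply: cvgM; [exact: cvg_cst|exact: continuous_tpow].
have [Cu uE] := Cm_seg_of_is_derive ab
  (fun k x => @is_derive_smooth_utility n c d k x) cont.
have sgn k : (-1) ^+ k * (-1) ^+ k = 1 :> R by rewrite -exprD addnn -mul2n exprM sqrrN !expr1n.
split; first split => // x; first rewrite in_itv/= => xab k /andP[_ kn].
  rewrite uE// /smooth_utility mulrN !mulrA sgn mul1r oppr_le0 subSn//.
  rewrite mulr_ge0 ?dtpow_ge0// divr_ge0//.
  by rewrite !mulr_ge0// ltW.
case=> [_|k kn]; first by rewrite /= subrr.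
have bab : a <= b <= b by rewrite lexx ltW.
have kn1 : (k.+1 <= n.+1)%N by exact: leqW (ltnW kn).
rewrite /rev_family uE// /smooth_utility subSn//.
(* The remaining degree is positive and all three knots are at most [b], so every term vanishes
   there. *)
rewrite /dtpow !tpow_gt//; first by rewrite mulr0 subrr add0r mulr0 oppr0 mulr0.
- by lra.
- by lra.
Qed.

(** The normalized second difference equals [tpow c n.+1] at a point within [2 * d] of [x]; the
    Lipschitz bound then gives an error uniform in [x]. *)
Lemma smooth_utility_approx n a c d x : 0 < d -> a <= x -> a <= c ->
  `|tpow c n.+1 x - - smooth_utility n.+1 c d 0 x| <= n.+1%:R * (c - a) ^+ n * (2 * d).
Proof.
move=> d0 ax ac; have [y /andP[xy yd] E] := dtpow_mvt c n x d0.
have -> : - smooth_utility n.+1 c d 0 x = tpow c n.+1 y.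
  rewrite /smooth_utility opprK expr0 ffactn0 mul1r subn0 E mulrA.
  rewrite div1r mulVf ?mul1r// mulf_neq0 ?pnatr_eq0// expf_neq0// lt0r_neq0//.
have axy : a <= x <= y by rewrite ax.
by have /andP[h0 h1] := tpow_modulus n axy yd ac; rewrite ger0_norm.
Qed.

End smoothing.

(** * Stochastic dominance *)

Definition mean {R : realType} (a b : R) (F : cumulativeBounded (0 : R) (1 : R)) (f : R -> R) : R :=
  fine (integral_seg a b F f).

(** What the comparison arguments need of integration against a probability on [[a, b]], kept apart
    from measure theory. *)
Definition seg_mean {R : realType} (a b : R) (I : (R -> R) -> R) : Prop :=
  [/\ forall k : R, I (fun=> k) = k,
      forall f g : R -> R, {within `[a, b], continuous f} -> {within `[a, b], continuous g} ->
        I (fun x => f x + g x) = I f + I g,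
      forall (k : R) (f : R -> R), {within `[a, b], continuous f} ->
        I (fun x => k * f x) = k * I f &
      forall f g : R -> R, {within `[a, b], continuous f} -> {within `[a, b], continuous g} ->
        (forall x, a <= x <= b -> f x <= g x) -> I f <= I g].

Section distribution_integrals.
Context {R : realType} (a b : R) (F : cumulativeBounded (0 : R) (1 : R)).
Hypothesis ab : a < b.
Hypothesis Fab : distribution_on a b F.
Implicit Types (f g : R -> R).

Let mu := lebesgue_stieltjes_measure F.

(** The half-line up to and including [b] has mass [F b = 1], and the open half-line below [a] is a
    countable union of null ones; an atom at [a] thus stays in the segment. *)
Lemma distribution_seg : mu `[a, b]%classic = 1%E.
Proof.
have [Fa Fb] := Fab.
have muNy r : mu `]-oo, r]%classic = (F r)%:E.
  exact: (cdf_lebesgue_stieltjes_id F r).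
have mua : mu `]-oo, a[%classic = 0%E.
  apply/eqP; rewrite eq_le measure_ge0 andbT.
  have -> : 0%E = mu (\bigcup_n `]-oo, a - n.+1%:R^-1]%classic).
    apply/esym/negligibleP; first exact: bigcup_measurable.
    apply: negligible_bigcup => n; apply/negligibleP => //.
    by apply: etrans (muNy _) _; rewrite Fa// gtrBl invr_gt0 ltr0n.
  apply: le_measure; rewrite ?inE//; first exact: bigcup_measurable.
  move=> x /=; rewrite in_itv/= => xa.
  (* This index makes [n.+1] exceed [(a - x)^-1], whence [x <= a - n.+1%:R^-1]. *)
  exists (Num.truncn (a - x)^-1) => //=; rewrite in_itv/= lerBrDr -lerBrDl.
  rewrite invf_ple ?posrE ?subr_gt0 ?ltr0n//; apply: ltW; exact: truncnS_gt.
have : mu (`]-oo, a[%classic `|` `[a, b]%classic) = 1%E.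
  rewrite -[RHS]/(1%:E) -Fb -muNy; congr (mu _); apply/seteqP; split => x /=; rewrite !in_itv/=.
    by case=> [xa|/andP[]//]; exact: ltW (lt_trans xa ab).
  by have [xa|ax] := ltP x a; [left|right].
have dis : `]-oo, a[%classic `&` `[a, b]%classic = set0.
  by apply/seteqP; split => x //=; rewrite !in_itv/= => -[xa /andP[]]; rewrite leNgt xa.
have muU : mu (`]-oo, a[%classic `|` `[a, b]%classic) =
    (mu `]-oo, a[%classic + mu `[a, b]%classic)%E.
  exact: (@measureU _ _ _ (lebesgue_stieltjes_measure F) _ _ _ _ dis).
by rewrite muU mua add0e.
Qed.

Let integrable_seg f : {within `[a, b], continuous f} -> mu.-integrable `[a, b] (EFin \o f).
Proof.
move=> cf; apply: measurable_bounded_integrable => //.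
- have mu_fin : (mu `[a, b]%classic < +oo)%E by rewrite distribution_seg ltry.
  exact: mu_fin.
- exact: measurable_realfun.subspace_continuous_measurable_fun.
- have [M [Mr Hm]] := compact_bounded (continuous_compact cf (@segment_compact _ a b)).
  by exists M; split => [//|] x Mx y yab; apply: Hm => //; exists y.
Qed.

Lemma integral_segE f : {within `[a, b], continuous f} ->
  integral_seg a b F f = (mean a b F f)%:E.
Proof.
move=> cf; rewrite fineK//; apply: integrable_fin_num => //; exact: integrable_seg.
Qed.

Lemma mean_seg_mean : seg_mean a b (mean a b F).
Proof.
split=> [k|f g cf cg|k f cf|f g cf cg fg].
- have -> : mean a b F (fun=> k) = k * fine (mu `[a, b]%classic).
    by apply: Rintegral_cst.
  by rewrite distribution_seg mulr1.
- by apply: RintegralD => //; exact: integrable_seg.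
- by apply: RintegralZl => //; exact: integrable_seg.
- by apply: le_Rintegral => //; exact: integrable_seg.
Qed.

End distribution_integrals.

(** * Comparison of positive functionals *)

Section positive_functionals.
Context {R : realType} (a b : R).
Hypothesis ab : a < b.
Implicit Types (I J : (R -> R) -> R) (n : nat) (f u : R -> R).

Let cst_continuous (k : R) : {within `[a, b], continuous (fun=> k)}.
Proof. by move=> z; exact: cvg_cst. Qed.

Let pw_continuous n s : {within `[a, b], continuous (@pw R n s)}.
Proof. exact/continuous_subspaceT/continuous_pw. Qed.

Let tpow_continuous c n : {within `[a, b], continuous (@tpow R c n)}.
Proof. exact/continuous_subspaceT/continuous_tpow. Qed.

Lemma seg_mean_pw I n s : seg_mean a b I ->
  I (pw n s) = \sum_(p <- s) p.1 * I (tpow p.2 n).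
Proof.
move=> [I1 ID IZ _]; elim: s => [|p s IH].
  have -> : pw n [::] = (fun=> 0 : R) by apply/funext => y; rewrite /pw big_nil.
  by rewrite big_nil I1.
rewrite big_cons -IH; have -> : pw n (p :: s) = (fun y => p.1 * tpow p.2 n y + pw n s y).
  by apply/funext => y; rewrite pw_cons.
by rewrite ID ?IZ//; exact: within_continuousMl.
Qed.

Lemma seg_mean_affine I (k l : R) u : seg_mean a b I -> {within `[a, b], continuous u} ->
  I (fun x => k + l * u x) = k + l * I u.
Proof.
move=> [I1 ID IZ _] cu; rewrite (ID (fun=> k)) ?I1 ?IZ//; exact: within_continuousMl.
Qed.

(** Constants are reproduced, so a uniform error [e / 2] costs at most [e / 2] under [I] and again
    under [J]. *)
Lemma le_of_approx I J f : seg_mean a b I -> seg_mean a b J ->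
  {within `[a, b], continuous f} ->
  (forall e, 0 < e -> exists g, [/\ {within `[a, b], continuous g},
     forall x, a <= x <= b -> `|f x - g x| <= e & I g <= J g]) ->
  I f <= J f.
Proof.
move=> [I1 ID _ Ile] [J1 JD _ Jle] cf H; apply/ler_addgt0Pr => e e0.
have e20 : 0 < e / 2 by rewrite divr_gt0.
have [g [cg fg IJg]] := H _ e20.
have cD h : {within `[a, b], continuous h} -> {within `[a, b], continuous (fun x => h x + e / 2)}.
  by move=> ch z; apply: cvgD; [exact: ch|exact: cvg_cst].
have h1 : I f <= I (fun x => g x + e / 2).
  by apply: (Ile _ _ cf (cD _ cg)) => x /fg; rewrite ler_distl => /andP[_].
have h2 : J g <= J (fun x => f x + e / 2).
  by apply: (Jle _ _ cg (cD _ cf)) => x /fg; rewrite distrC ler_distl => /andP[_].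
move: h1 h2; rewrite (ID _ (fun=> e / 2))// (JD _ (fun=> e / 2))// I1 J1; lra.
Qed.

Lemma U_continuous n u : U_class n a b u -> {within `[a, b], continuous u}.
Proof. by move=> [Cu _]; case: (Cm_seg_deriv_on Cu (ltn0Sn n)). Qed.

Lemma le_of_tpow_le I J n u : seg_mean a b I -> seg_mean a b J -> (0 < n)%N ->
  (forall c, a <= c <= b -> J (tpow c n) <= I (tpow c n)) ->
  U_class n a b u -> flat a b n u -> I u <= J u.
Proof.
case: n => // n mI mJ _ IJ Uu fu; have cu := U_continuous Uu.
have alt := alternating_rev_family Uu.
(* Passing to [u b - u], the function that the cone approximates, reverses the inequality. *)
suff : J (fun x => u b + -1 * u x) <= I (fun x => u b + -1 * u x).
  by rewrite !seg_mean_affine//; lra.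
apply: le_of_approx => // [|e e0].
  by move=> z; apply: cvgD; [exact: cvg_cst|exact: within_continuousMl].
have [s [cs sa]] := approx_cone ab alt fu e0.
exists (pw n.+1 s); split => //.
  by move=> x xab; rewrite mulN1r; exact: sa.
rewrite !seg_mean_pw// big_seq [leRHS]big_seq; apply: ler_sum => p /cs[p0 pab].
by rewrite ler_wpM2l// IJ.
Qed.

Lemma tpow_le_of_le I J n c : seg_mean a b I -> seg_mean a b J -> (0 < n)%N ->
  (forall u, U_class n a b u -> flat a b n u -> I u <= J u) ->
  a <= c <= b -> J (tpow c n) <= I (tpow c n).
Proof.
case: n => // n mI mJ _ H /andP[ac cb]; apply: le_of_approx => // e e0.
pose K := n.+1%:R * (c - a) ^+ n * 2.
have K0 : 0 <= K by rewrite /K !mulr_ge0// ?exprn_ge0 ?subr_ge0.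
have K1 : 0 < 1 + K by rewrite ltr_pwDl.
(* Then the smoothing error [K * d] is at most [e]. *)
pose d := e / (1 + K); have d0 : 0 < d by rewrite divr_gt0.
have [Uu fu] := @smooth_utility_U_flat R a b n.+1 c d ab d0 cb.
set u := smooth_utility n.+1 c d 0 in Uu fu; have cu := U_continuous Uu.
exists (fun x => 0 + -1 * u x); split.
- by move=> z; apply: cvgD; [exact: cvg_cst|exact: within_continuousMl].
- move=> x /andP[ax xb]; rewrite add0r mulN1r.
  apply: (le_trans (smooth_utility_approx n d0 ax ac)); rewrite mulrA -/K /d mulrA.
  by rewrite ler_pdivrMr// mulrC ler_pM2l// lerDr.
by rewrite !seg_mean_affine//; have := H u Uu fu; lra.
Qed.

End positive_functionals.

Theorem theorem1 (R : realType) (a b : R) (n : nat) (hab : a < b) (hn : (0 < n)%N) :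
  (forall F G : cumulativeBounded (0 : R) (1 : R),
     distribution_on a b F -> distribution_on a b G ->
     (BSD n a b G F <->
        (forall u : R -> R, (U_class n a b `&` LP_class n a b) u ->
           (integral_seg a b F u <= integral_seg a b G u)%E)) /\
     ((forall u : R -> R, (U_class n a b `&` LP_class n a b) u ->
         (integral_seg a b F u <= integral_seg a b G u)%E) <->
      (forall u : R -> R, (U_class n a b `&` AP_class n a b) u ->
         (integral_seg a b F u <= integral_seg a b G u)%E))) /\
  U_class n a b `&` AP_class n a b = U_class n a b `&` LP_class n a b.
Proof.
have E := U_AP_eq_U_LP hab hn; split; last exact: E.
(* Equality of the two intersections makes the second equivalence trivial; only BSD against LP
   remains. *)
move=> F G Fab Gab; rewrite E; split; last exact: iff_refl.
have mF := mean_seg_mean hab Fab; have mG := mean_seg_mean hab Gab.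
have le_mean f : {within `[a, b], continuous f} ->
    (integral_seg a b F f <= integral_seg a b G f)%E = (mean a b F f <= mean a b G f).
  by move=> cf; rewrite (integral_segE hab Fab cf) (integral_segE hab Gab cf) lee_fin.
have ct c : {within `[a, b], continuous (tpow c n)}.
  exact/continuous_subspaceT/continuous_tpow.
split.
  move=> GF u [Uu /(flat_of_LP hab hn Uu) fu].
  rewrite (le_mean u (U_continuous Uu)).
  apply: (le_of_tpow_le hab mF mG hn) Uu fu => c cab.
  have := GF c; rewrite in_itv/= => /(_ cab).
  by rewrite -/(tpow c n) (integral_segE hab Fab (ct c)) (integral_segE hab Gab (ct c)) lee_fin.
move=> H c; rewrite in_itv/= => cab.
rewrite -/(tpow c n) (integral_segE hab Fab (ct c)) (integral_segE hab Gab (ct c)) lee_fin.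
apply: (tpow_le_of_le hab mF mG hn) cab => u Uu fu.
by rewrite -(le_mean u (U_continuous Uu)); apply: H; split; [exact: Uu|exact: LP_of_flat].
Qed.
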